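(* Let $R$ be a commutative ring with unity such that $R=2R$ (equivalently, $2$ is a unit in $R$), let $n\geq 2$, and let $\varphi$ be a skew-symmetric matrix of Pfaffian $1$ of size $2n\times 2n$ over $R$. Let $I$ be an ideal of $R$. Then the relative elementary symplectic group $\mathrm{ESp}_{\varphi}(R,I)$ is a normal subgroup of $\mathrm{Sp}_{\varphi}(R)$.
   Context: $R^m$ denotes the set of column vectors with $m$ entries in $R$, and $I^m\subseteq R^m$ the columns with all entries in $I$. The Pfaffian is normalized so that the standard matrix $\psi_n=\sum_{i=1}^n(e_{2i-1,2i}-e_{2i,2i-1})$ has Pfaffian $1$. A skew-symmetric matrix of Pfaffian $1$ is invertible. For an invertible skew-symmetric matrix $\varphi$ of size $2n$ over $R$, put $\mathrm{Sp}_{\varphi}(R)=\{\alpha\in \mathrm{GL}_{2n}(R) : \alpha^t\varphi\alpha=\varphi\}$. Write in block form $$\varphi=\begin{pmatrix}0&-c^t\\ c&\nu\end{pmatrix},\qquad \varphi^{-1}=\begin{pmatrix}0&d^t\\ -d&\mu\end{pmatrix},\qquad c,d\in R^{2n-1},$$ with $\nu,\mu$ of size $(2n-1)\times(2n-1)$. For $v\in R^{2n-1}$ define $$\alpha_\varphi(v)=I_{2n-1}+d v^t\nu,\quad \beta_\varphi(v)=I_{2n-1}+\mu v c^t,\quad C_\varphi(v)=\begin{pmatrix}1&0\\ v&\alpha_\varphi(v)\end{pmatrix},\quad R_\varphi(v)=\begin{pmatrix}1&v^t\\ 0&\beta_\varphi(v)\end{pmatrix}.$$ These matrices lie in $\mathrm{Sp}_\varphi(R)$.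 The elementary symplectic group $\mathrm{ESp}_\varphi(R)$ is the subgroup of $\mathrm{Sp}_\varphi(R)$ generated by all $C_\varphi(v)$ and $R_\varphi(v)$ with $v\in R^{2n-1}$. For an ideal $I$ of $R$, $\mathrm{ESp}_\varphi(I)$ is the subgroup generated by all $C_\varphi(v)$ and $R_\varphi(v)$ with $v\in I^{2n-1}$, and $\mathrm{ESp}_\varphi(R,I)$ is the normal closure of $\mathrm{ESp}_\varphi(I)$ in $\mathrm{ESp}_\varphi(R)$. *)

(* Defs.v *)
From mathcomp Require Import all_boot all_order all_fingroup all_algebra.

Set Implicit Arguments.
Unset Strict Implicit.
Unset Printing Implicit Defensive.

Import GRing.Theory.
Local Open Scope ring_scope.

(* The library's [idealr_closed] only covers proper ideals; here I = R is
   allowed. *)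
Definition is_ideal (R : comUnitRingType) (I : R -> Prop) : Prop :=
  [/\ I 0,
      forall x y, I x -> I y -> I (x + y)
    & forall a x, I x -> I (a * x)].

(* The permutations s with s 0 < s 1, s 2 < s 3, ... and s 0 < s 2 < s 4 < ...
   represent each perfect matching {{s 0, s 1}, {s 2, s 3}, ...} of 'I_N
   exactly once. *)
Definition matching_perm (N : nat) (s : 'S_N) : bool :=
  [forall i : 'I_N, forall j : 'I_N,
     (~~ odd i && (j == i.+1 :> nat)) ==> (s i < s j)%N]
  && [forall i : 'I_N, forall j : 'I_N,
     [&& ~~ odd i, ~~ odd j & (i < j)%N] ==> (s i < s j)%N].

(* Only meaningful for even N.  The inner product has exactly one factor,
   namely A (s i) (s i.+1). *)
Definition pfaffian (R : comUnitRingType) (N : nat) (A : 'M[R]_N) : R :=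
  \sum_(s : 'S_N | matching_perm s)
    (-1) ^+ s *
    \prod_(i < N | ~~ odd i) \prod_(j < N | j == i.+1 :> nat) A (s i) (s j).

Definition psi (R : comUnitRingType) (N : nat) : 'M[R]_N :=
  \matrix_(i, j) ((~~ odd i && (j == i.+1 :> nat))%:R
                  - (~~ odd j && (i == j.+1 :> nat))%:R).

Lemma pfaffian_psi (R : comUnitRingType) (n : nat) :
  pfaffian (psi R (2 * n)) = 1.
Proof.
rewrite /pfaffian (bigD1 (1%g : 'S_(2 * n))) /=; last first.
  apply/andP; split; apply/forallP => i; apply/forallP => j; apply/implyP.
    by case/andP=> _ /eqP ji; rewrite !perm1 ji.
  by case/and3P=> _ _ ij; rewrite !perm1.
rewrite odd_perm1 expr0 mul1r [X in X + _]big1 => [|i ei]; last first.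
  rewrite big1 // => j /eqP ji; rewrite !perm1 mxE ei ji eqxx /=.
  by rewrite ltn_eqF ?andbF ?subr0 // ltnW.
rewrite big1 ?addr0 // => s /andP[/andP[/forallP s1 /forallP s2] sN1].
apply: contraNeq sN1 => nz.
have step (i j : 'I_(2 * n)) :
    ~~ odd i -> j = i.+1 :> nat -> s j = (s i).+1 :> nat.
  move=> ei ji; apply/eqP; apply: contraNT nz => sji.
  rewrite (bigD1 i) //= (bigD1 j) ?ji //= mxE (negbTE sji) andbF sub0r.
  have/forallP/(_ j) := s1 i; rewrite ei ji eqxx /= => lt_s.
  by rewrite ltn_eqF ?andbF ?oppr0 ?mul0r ?mulr0 // ltnW.
have incr (i j : 'I_(2 * n)) : j = i.+1 :> nat -> (s i < s j)%N.
  move=> ji; have [oi|ei] := boolP (odd i); last by rewrite (step i j).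
  have i0 : (0 < i)%N by case: (nat_of_ord i) oi.
  pose k : 'I_(2 * n) := Ordinal (leq_ltn_trans (leq_pred i) (ltn_ord i)).
  have ki : i = k.+1 :> nat by rewrite /= prednK.
  have ek : ~~ odd k by move: oi; rewrite ki.
  rewrite (step k i) //; have/forallP/(_ j) := s2 k.
  rewrite ek ji ki /= ek ltnW //= => lt_kj.
  rewrite ltn_neqAle lt_kj andbT -(step k i) //.
  by apply/eqP => /val_inj/perm_inj ij; move: ji; rewrite -ij => /n_Sn.
have ge_s m (lt_m : (m < 2 * n)%N) : (m <= s (Ordinal lt_m))%N.
  elim: m lt_m => // m IH lt_m.
  exact: leq_ltn_trans (IH (ltnW lt_m)) (incr (Ordinal (ltnW lt_m)) _ _).
have /leqif_sum/= : forall i : 'I_(2 * n), true ->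
    (i <= s i ?= iff (i == s i :> nat))%N.
  move=> i _; split=> //; have := ge_s i (ltn_ord i).
  by rewrite (_ : Ordinal _ = i) //; apply: val_inj.
case=> _; rewrite [X in X == _](reindex_inj (@perm_inj _ s)) /= eqxx.
move=> /esym/forallP Es; apply/eqP/permP => i; apply: val_inj; rewrite perm1.
by have /= /eqP <- := Es i.
Qed.

Section MatrixGroups.

Variables (R : comUnitRingType) (N : nat).
Implicit Types (S H G : 'M[R]_N -> Prop).

Definition is_subgroup H : Prop :=
  [/\ forall x, H x -> x \in unitmx,
      H 1%:M,
      forall x y, H x -> H y -> H (x *m y)
    & forall x, H x -> H (invmx x)].

Definition is_normal_subgroup H G : Prop :=
  [/\ is_subgroup G,
      is_subgroup H,
      forall x, H x -> G x
    & forall g x, G g -> H x -> H (g *m x *m invmx g)].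

Definition generated S : 'M[R]_N -> Prop :=
  fun x => forall H, is_subgroup H -> (forall y, S y -> H y) -> H x.

Definition normal_closure S G : 'M[R]_N -> Prop :=
  fun x => forall H, is_normal_subgroup H G -> (forall y, S y -> H y) -> H x.

End MatrixGroups.

(* phi has size 1 + m, with m = 2n - 1, so that the library's block
   decomposition applies directly. *)
Section Symplectic.

Variables (R : comUnitRingType) (m : nat) (phi : 'M[R]_(1 + m)).

Definition Sp : 'M[R]_(1 + m) -> Prop :=
  fun a => a \in unitmx /\ a^T *m phi *m a = phi.

Definition phi_c : 'cV[R]_m := dlsubmx phi.
Definition phi_nu : 'M[R]_m := drsubmx phi.
Definition phi_d : 'cV[R]_m := - dlsubmx (invmx phi).
Definition phi_mu : 'M[R]_m := drsubmx (invmx phi).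

Definition alpha_mx (v : 'cV[R]_m) : 'M[R]_m :=
  1%:M + phi_d *m v^T *m phi_nu.
Definition beta_mx (v : 'cV[R]_m) : 'M[R]_m :=
  1%:M + phi_mu *m v *m phi_c^T.

Definition C_mx (v : 'cV[R]_m) : 'M[R]_(1 + m) :=
  block_mx 1%:M 0 v (alpha_mx v).
Definition R_mx (v : 'cV[R]_m) : 'M[R]_(1 + m) :=
  block_mx 1%:M v^T 0 (beta_mx v).

Definition elem_gen (I : R -> Prop) : 'M[R]_(1 + m) -> Prop :=
  fun x => exists2 v : 'cV[R]_m, forall i, I (v i 0) & x = C_mx v \/ x = R_mx v.

Definition ESp (I : R -> Prop) : 'M[R]_(1 + m) -> Prop :=
  generated (elem_gen I).

Definition ESp_full : 'M[R]_(1 + m) -> Prop := ESp (fun _ => True).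

Definition ESp_rel (I : R -> Prop) : 'M[R]_(1 + m) -> Prop :=
  normal_closure (ESp I) ESp_full.

End Symplectic.

(* Main.v *)
Require Import Defs.
From mathcomp Require Import all_boot all_order all_fingroup all_algebra.
From mathcomp Require Import ring zify.

(* Write <x, y> = x^T phi y and let tv u w, for <u, w> = 0, be the transvection
   x |-> x - <u, x> w - <w, x> u, which is symmetric in u and w.  With e the first
   basis vector and f = phi^-1 e, the matrices R_phi(v) and C_phi(v) are the tv e w
   and tv f w, so it suffices to show that tv u (b w) lies in ESp(R, I) for b in I,
   u in the Sp-orbit of e or f, and all w orthogonal to u.  Fix u.  The vectors w
   with this property form a submodule W of the orthogonal of u, and
   - conjugating tv v (b/2 v), for v = u - <u, f> e, by tv e z puts <e, u> z in W
     when z is orthogonal to e and u;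
   - commutators of such transvections put <e, u>^4 <p, q> u in W for p, q
     orthogonal to e, and the <p, q> generate the unit ideal because n >= 2;
   - hence <e, u>^5 w is in W for every w orthogonal to u.
   Likewise for <f, u>, and for <e - p, u> since e - p is in the ESp-orbit of e; as u
   is unimodular these elements generate the unit ideal, so W is everything.
   Taking I = R first gives the normality of ESp(R) itself.
   The Pfaffian only serves to make phi invertible: expanding along a row gives a
   matrix B with phi B = Pf(phi), the off-diagonal entries being Pfaffians of matrices
   with two equal rows and columns, which vanish since 2 is invertible. *)

Set Implicit Arguments.
Unset Strict Implicit.
Unset Printing Implicit Defensive.

Import GRing.Theory.
Local Open Scope ring_scope.

(** * Ideals and matrix groups *)

Section Ideals.

Variables (R : comUnitRingType) (J : R -> Prop).
Hypothesis hJ : is_ideal J.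

Lemma ideal0 : J 0. Proof. by case: hJ. Qed.
Lemma idealD x y : J x -> J y -> J (x + y). Proof. by case: hJ => _ H _; apply: H. Qed.
Lemma idealMl a x : J x -> J (a * x). Proof. by case: hJ => _ _; apply. Qed.
Lemma idealMr a x : J x -> J (x * a). Proof. by rewrite mulrC; apply: idealMl. Qed.
Lemma ideal_sum (T : finType) (F : T -> R) :
  (forall i, J (F i)) -> J (\sum_i F i).
Proof. by move=> H; apply: big_ind => //; [exact: ideal0 | exact: idealD]. Qed.

(** Every term of the binomial expansion has at least [m] factors [x] or at least [k] factors [y].
    Hence powers of generators of the unit ideal still generate it. *)
Lemma idealXD x y m k : J (x ^+ m) -> J (y ^+ k) -> J ((x + y) ^+ (m + k)).
Proof.
move=> Jx Jy; rewrite exprDn; apply: ideal_sum => i; rewrite -mulr_natl.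
apply: idealMl; case: (leqP k i) => [ki | /ltnW ik].
  by apply: idealMl; rewrite -(subnKC ki) exprD; apply: idealMr.
by apply: idealMr; rewrite -addnBA // exprD; apply: idealMr.
Qed.

End Ideals.

Section Subgroups.

Variables (R : comUnitRingType) (N : nat) (H : 'M[R]_N -> Prop).
Hypothesis sH : is_subgroup H.

Lemma subgroup_unit x : H x -> x \in unitmx. Proof. by case: sH => h _ _ _; apply: h. Qed.
Lemma subgroup1 : H 1%:M. Proof. by case: sH. Qed.
Lemma subgroupM x y : H x -> H y -> H (x *m y).
Proof. by case: sH => _ _ h _; apply: h. Qed.
Lemma subgroupV x : H x -> H (invmx x). Proof. by case: sH => _ _ _; apply. Qed.

Lemma subgroupMl x y : H x -> H (x *m y) -> H y.
Proof.
move=> Hx Hxy; rewrite -(mulKmx (subgroup_unit Hx) y).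
by apply: subgroupM => //; apply: subgroupV.
Qed.

End Subgroups.

Section Generated.

Variables (R : comUnitRingType) (N : nat).
Implicit Types S H G : 'M[R]_N -> Prop.

(** [generated S] is an intersection of subgroups; the given [H] makes this family nonempty, which
    is where the invertibility of the elements comes from. *)
Lemma generated_subgroup S H :
  is_subgroup H -> (forall x, S x -> H x) -> is_subgroup (Defs.generated S).
Proof.
move=> sH SH; split=> [x Gx||x y Gx Gy|x Gx].
- exact: (subgroup_unit sH (Gx _ sH SH)).
- by move=> K sK _; apply: subgroup1.
- by move=> K sK SK; apply: (subgroupM sK); [apply: Gx | apply: Gy].
- by move=> K sK SK; apply: (subgroupV sK); apply: Gx.
Qed.

Lemma subgroup_normal G : is_subgroup G -> is_normal_subgroup G G.
Proof.
move=> sG; split=> // g x Gg Gx.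
by do !apply: (subgroupM sG) => //; apply: subgroupV.
Qed.

Lemma normal_closure_normal S G : is_subgroup G -> (forall x, S x -> G x) ->
  is_normal_subgroup (normal_closure S G) G.
Proof.
move=> sG SG; have nG := subgroup_normal sG.
have sub x : normal_closure S G x -> G x by move/(_ _ nG SG).
split=> //; last first.
  by move=> g x Gg Cx H nH SH; have [_ _ _] := nH; apply=> //; apply: Cx.
split=> [x /sub /(subgroup_unit sG) //||x y Cx Cy|x Cx] H nH SH;
  have [_ sH _ _] := nH.
- exact: subgroup1.
- by apply: (subgroupM sH); [apply: Cx | apply: Cy].
- by apply: (subgroupV sH); apply: Cx.
Qed.

End Generated.

Lemma invmx_conj (R : comUnitRingType) (N : nat) (g x : 'M[R]_N) :
  g \in unitmx -> x \in unitmx ->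
  invmx (g *m x *m invmx g) = g *m invmx x *m invmx g.
Proof.
move=> gu xu.
have yu : g *m x *m invmx g \in unitmx by rewrite !unitmx_mul unitmx_inv gu xu.
apply: (can_inj (mulKmx yu)); rewrite mulmxV // !mulmxA mulmxKV // mulmxK //.
by rewrite mulmxV.
Qed.

(** Turns a property of conjugates into a predicate to which membership in [generated] applies, so
    that only conjugates of generators need to be examined. *)
Lemma conj_subgroup (R : comUnitRingType) (N : nat) (H : 'M[R]_N -> Prop)
    (g : 'M[R]_N) : g \in unitmx -> is_subgroup H ->
  is_subgroup (fun x => H (g *m x *m invmx g)).
Proof.
move=> gu sH; split=> [x Hx||x y Hx Hy|x Hx].
- have := subgroup_unit sH Hx.
  by rewrite !unitmx_mul unitmx_inv gu andbT.
- by rewrite mulmx1 mulmxV //; apply: subgroup1.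
- by have := subgroupM sH Hx Hy; rewrite !mulmxA mulmxKV.
have xu : x \in unitmx.
  by have := subgroup_unit sH Hx; rewrite !unitmx_mul unitmx_inv gu andbT.
by have := subgroupV sH Hx; rewrite invmx_conj.
Qed.

(** * Transvections *)

Lemma mx_ext (R : comUnitRingType) (N : nat) (A B : 'M[R]_N) :
  (forall x : 'cV_N, A *m x = B *m x) -> A = B.
Proof.
move=> AB; apply/matrixP => i j; have := AB (delta_mx j 0).
by rewrite -!colE => /colP/(_ i); rewrite !mxE.
Qed.

Section Transvections.

Variables (R : comUnitRingType) (N : nat) (phi : 'M[R]_N).
Hypothesis h2 : (2%:R : R) \is a GRing.unit.
Hypothesis skew : phi^T = - phi.
Implicit Types (x y z u v w : 'cV[R]_N).

Definition pairing x y : R := (x^T *m phi *m y) 0 0.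

Local Notation "<< x , y >>" := (pairing x y) (format "<< x ,  y >>").
Local Notation h := (2%:R^-1 : R).

Lemma formDr x y z : <<x, y + z>> = <<x, y>> + <<x, z>>.
Proof. by rewrite /pairing mulmxDr mxE. Qed.
Lemma formNr x y : <<x, - y>> = - <<x, y>>.
Proof. by rewrite /pairing mulmxN mxE. Qed.
Lemma formZr a x y : <<x, a *: y>> = a * <<x, y>>.
Proof. by rewrite /pairing -scalemxAr mxE. Qed.
Lemma formC x y : <<x, y>> = - <<y, x>>.
Proof.
rewrite /pairing -[_ 0 0]/((_ : 'M_1) 0 0) -[in LHS](trmxK (_ *m y)) mxE.
by rewrite !trmx_mul trmxK skew mulNmx mulmxN mxE mulmxA.
Qed.
Lemma formDl x y z : <<x + y, z>> = <<x, z>> + <<y, z>>.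
Proof. by rewrite formC formDr opprD -!formC. Qed.
Lemma formNl x y : <<- x, y>> = - <<x, y>>.
Proof. by rewrite formC formNr -formC. Qed.
Lemma formZl a x y : <<a *: x, y>> = a * <<x, y>>.
Proof. by rewrite formC formZr -mulrN -formC. Qed.

Lemma halfD : h + h = 1.
Proof. by rewrite -[h]mul1r -mulrDl mulrV. Qed.

Lemma half_split a : a = h * a + h * a.
Proof. by rewrite -mulrDl halfD mul1r. Qed.

Lemma formxx x : <<x, x>> = 0.
Proof.
apply: (mulrI h2); rewrite mulr0 mulr_natl mulr2n.
by rewrite {1}formC addNr.
Qed.

Lemma form0r x : <<x, 0>> = 0. Proof. by rewrite -(scale0r x) formZr mul0r. Qed.

Lemma formC0 x y : <<x, y>> = 0 -> <<y, x>> = 0.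
Proof. by rewrite formC => /eqP; rewrite oppr_eq0 => /eqP. Qed.

Lemma form_sumr x (T : finType) (F : T -> 'cV[R]_N) :
  <<x, \sum_i F i>> = \sum_i <<x, F i>>.
Proof. by apply: (big_morph (pairing x)) => [y z|]; rewrite ?formDr ?form0r. Qed.

Definition formE := (formDl, formDr, formNl, formNr, formZl, formZr).

Definition tv u w : 'M[R]_N :=
  1%:M - w *m (u^T *m phi) - u *m (w^T *m phi).

Lemma tvE u w x : tv u w *m x = x - <<u, x>> *: w - <<w, x>> *: u.
Proof.
have E y z : y *m (z^T *m phi) *m x = <<z, x>> *: y.
  by rewrite -mulmxA (mx11_scalar (_ *m x)) mul_mx_scalar.
by rewrite !mulmxBl mul1mx !E.
Qed.

Lemma tvC u w : tv u w = tv w u.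
Proof. by rewrite /tv addrAC. Qed.

Lemma tvZ a u w : tv u (a *: w) = tv (a *: u) w.
Proof.
by rewrite /tv [(a *: w)^T]linearZ [(a *: u)^T]linearZ /= -!scalemxAl -!scalemxAr.
Qed.

Lemma tv0 u : tv u 0 = 1%:M.
Proof. by rewrite /tv trmx0 mul0mx mul0mx mulmx0 !subr0. Qed.

(** For fixed [u] these transvections form a group of Heisenberg type, with the multiples of [u]
    central. The half appears because both rank one terms of [tv u (a *: u)] are equal. *)
Lemma tvM u w w' : <<u, w>> = 0 -> <<u, w'>> = 0 ->
  tv u w *m tv u w' = tv u (w + w' - (h * <<w, w'>>) *: u).
Proof.
move=> uw uw'; apply: mx_ext => x; rewrite -mulmxA !tvE !formE uw' formxx.
rewrite (formC w u) uw; apply/colP => i; rewrite !mxE.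
(* The pairing becomes [c + c] with [c] a variable, so that [ring] meets no inverse. *)
by move: (h * _) (half_split <<w, w'>>) => c ->; ring.
Qed.

Lemma tvMV u w : <<u, w>> = 0 -> tv u w *m tv u (- w) = 1%:M.
Proof.
move=> uw; rewrite tvM ?formNr ?uw ?oppr0 // formxx oppr0 mulr0 scale0r.
by rewrite subr0 subrr tv0.
Qed.

Lemma tv_unit u w : <<u, w>> = 0 -> tv u w \in unitmx.
Proof. by move/tvMV/mulmx1_unit=> []. Qed.

Lemma tvV u w : <<u, w>> = 0 -> invmx (tv u w) = tv u (- w).
Proof.
by move=> uw; rewrite -[LHS]mulmx1 -(tvMV uw) mulKmx ?tv_unit.
Qed.

Lemma tv_commutator u w w' : <<u, w>> = 0 -> <<u, w'>> = 0 ->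
  tv u w *m tv u w' *m invmx (tv u w) *m invmx (tv u w') =
    tv u (- <<w, w'>> *: u).
Proof.
move=> uw uw'; rewrite !tvV // -mulmxA !tvM //; last first.
- by rewrite formNr uw' oppr0.
- by rewrite formNr uw oppr0.
- by rewrite !formE formxx uw uw'; ring.
- by rewrite !formE formxx uw uw'; ring.
congr tv; rewrite !formE !formxx (formC w' w) ?(formC w u) ?(formC w' u) ?uw ?uw'.
apply/colP => i; rewrite !mxE.
rewrite [X in _ = - X * _]half_split; ring.
Qed.

(** Polarization: [tv y (k *: y)] is quadratic in [y], and at [y = v - c *: z] its cross term is a
    transvection mixing [v] and [z]. *)
Lemma tv_square v z c k : <<v, z>> = 0 ->
  tv (v - c *: z) (k *: (v - c *: z)) =
    tv v (k *: v) *m tv v (((k + k) * c) *: - z) *m tv z (k * c * c *: z).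
Proof.
move=> vz; apply: mx_ext => x; rewrite -!mulmxA !tvE !formE !formxx vz.
by apply/colP => i; rewrite !mxE; ring.
Qed.

Definition isometry (g : 'M[R]_N) := g \in unitmx /\ g^T *m phi *m g = phi.

Lemma isometry_form g x y : isometry g -> <<g *m x, g *m y>> = <<x, y>>.
Proof.
by case=> _ gE; rewrite /pairing trmx_mul -{2}gE !mulmxA.
Qed.

Lemma form_isometry g : g \in unitmx ->
  (forall x y, <<g *m x, g *m y>> = <<x, y>>) -> isometry g.
Proof.
move=> gu H; split=> //; apply: mx_ext => y; apply/colP => i.
have := H (delta_mx i 0) y; rewrite /pairing trmx_mul trmx_delta.
by rewrite -!mulmxA -!rowE !mulmxA !mxE -!mulmxA.
Qed.

Lemma isometry_subgroup : is_subgroup isometry.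
Proof.
split=> [x [] //||x y [xu Ex] [yu Ey]|x [xu Ex]].
- by split; rewrite ?unitmx1 // trmx1 mul1mx mulmx1.
- split; first by rewrite unitmx_mul xu.
  by rewrite trmx_mul -[RHS]Ey -[in RHS]Ex !mulmxA.
split; first by rewrite unitmx_inv.
by rewrite -{1}Ex trmx_inv !mulmxA mulVmx ?unitmx_tr // mul1mx mulmxK.
Qed.

Lemma tv_isometry u w : <<u, w>> = 0 -> isometry (tv u w).
Proof.
move=> uw; apply: form_isometry => [|x y]; first exact: tv_unit.
rewrite !tvE !formE !formxx (formC w u) uw (formC x u) (formC x w); ring.
Qed.

Lemma tvJ g u w : isometry g ->
  g *m tv u w *m invmx g = tv (g *m u) (g *m w).
Proof.
move=> gI; have gu := gI.1.
apply: mx_ext => x; have [y ->] : exists y, x = g *m y.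
  by exists (invmx g *m x); rewrite mulKVmx.
rewrite -!mulmxA mulKmx // !tvE !isometry_form // !mulmxBr.
by rewrite -!scalemxAr.
Qed.

(** * Transvections in a group [EI] normalized by a group [E] of isometries *)

Section NormalPair.

Variables (E EI : 'M[R]_N -> Prop) (I : R -> Prop).
Hypothesis hI : is_ideal I.
Hypotheses (sE : is_subgroup E) (sEI : is_subgroup EI).
Hypothesis nEI : forall g x : 'M_N, E g -> EI x -> EI (g *m x *m invmx g).
Hypothesis isoE : forall g, E g -> isometry g.

Lemma comm_normal (g x : 'M_N) : E g -> EI x -> EI (x *m g *m invmx x *m invmx g).
Proof.
move=> Eg Ex; rewrite -mulmxA -mulmxA; apply: (subgroupM sEI) => //.
by rewrite mulmxA; apply: nEI => //; apply: subgroupV.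
Qed.

Lemma tv_add u w w' : <<u, w>> = 0 -> <<u, w'>> = 0 -> <<w, w'>> = 0 ->
  EI (tv u w) -> EI (tv u w') -> EI (tv u (w + w')).
Proof.
move=> uw uw' ww' H H'; have := subgroupM sEI H H'.
by rewrite tvM // ww' mulr0 scale0r subr0.
Qed.

(** The last hypothesis restores the multiple of [u] that [tvM] subtracts. *)
Lemma tv_addh u w w' : <<u, w>> = 0 -> <<u, w'>> = 0 ->
  EI (tv u w) -> EI (tv u w') -> EI (tv u ((h * <<w, w'>>) *: u)) ->
  EI (tv u (w + w')).
Proof.
move=> uw uw' H H' Hu.
have := subgroupM sEI (subgroupM sEI H H') Hu.
rewrite tvM // tvM; try by rewrite !formE ?uw ?uw' formxx; ring.
rewrite !formE (formC w u) (formC w' u) uw uw' formxx.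
by rewrite (_ : _ - _ = w + w') //; apply/colP => i; rewrite !mxE; ring.
Qed.

Lemma tv_cancel u w w' : <<u, w>> = 0 -> <<u, w'>> = 0 -> <<w, w'>> = 0 ->
  EI (tv u w) -> EI (tv u (w + w')) -> EI (tv u w').
Proof.
move=> uw uw' ww' H H'; apply: (subgroupMl sEI H).
by rewrite tvM // ww' mulr0 scale0r subr0.
Qed.

Lemma tvN u w : <<u, w>> = 0 -> EI (tv u w) -> EI (tv u (- w)).
Proof. by move=> uw H; rewrite -tvV //; apply: (subgroupV sEI). Qed.

Section HyperbolicPair.

Variables e f : 'cV[R]_N.
Hypothesis ef : <<e, f>> = 1.
Hypotheses (Ee : forall z, <<e, z>> = 0 -> E (tv e z))
  (Ie : forall b z, I b -> <<e, z>> = 0 -> EI (tv e (b *: z)))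
  (If : forall b z, I b -> <<f, z>> = 0 -> EI (tv f (b *: z))).

(** Conjugation by [tv e y] fixes [z] and moves [f] to [f - y]; dividing the conjugate of
    [tv f (b *: z)] by [tv f (b *: z)] leaves the wanted transvection up to sign. *)
Lemma perp2_tv b y z : I b -> <<e, y>> = 0 -> <<f, y>> = 0 ->
  <<e, z>> = 0 -> <<f, z>> = 0 -> <<y, z>> = 0 -> EI (tv y (b *: z)).
Proof.
move=> Ib ey fy ez fz yz.
have := nEI (Ee ey) (If Ib fz); rewrite tvJ; last exact: tv_isometry.
rewrite -scalemxAr !tvE ef ez yz !scale0r !subr0 (formC y f) fy oppr0 scale0r.
rewrite subr0 scale1r tvC => H.
rewrite tvC -[y]opprK; apply: tvN; first by rewrite !formE (formC z) yz; ring.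
apply: (tv_cancel _ _ _ _ H);
  rewrite ?formE ?(formC z f) ?(formC z y) ?yz ?fy ?fz; try ring.
by rewrite tvC; apply: If.
Qed.

Lemma hyperbolic_decomp x : exists p, [/\ x = <<x, f>> *: e + <<e, x>> *: f + p,
  <<e, p>> = 0 & <<f, p>> = 0].
Proof.
exists (x - <<x, f>> *: e - <<e, x>> *: f); split.
- by apply/colP => i; rewrite !mxE; ring.
- by rewrite !formE formxx ef; ring.
- by rewrite !formE formxx (formC f e) ef (formC f x); ring.
Qed.

(** Being orthogonal to [e], both vectors lack an [f]-component. The parts involving [e] are
    transvections along [e], and the remaining parts [p], [q] fall under [perp2_tv]. *)
Lemma perp_tv b z z' : I b -> <<e, z>> = 0 -> <<e, z'>> = 0 ->
  <<z, z'>> = 0 -> EI (tv z (b *: z')).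
Proof.
move=> Ib ez ez' zz'.
have [p [Ez ep fp]] := hyperbolic_decomp z; have [q [Ez' eq fq]] := hyperbolic_decomp z'.
rewrite ez scale0r addr0 in Ez; rewrite ez' scale0r addr0 in Ez'.
have pz' : <<p, z'>> = 0.
  by move: zz'; rewrite {1}Ez !formE ez' mulr0 add0r.
have pq : <<p, q>> = 0.
  by move: pz'; rewrite Ez' !formE (formC p e) ep oppr0 mulr0 add0r.
rewrite tvZ tvC Ez scalerDr; apply: tv_add.
- by rewrite !formE (formC z' e) ez'; ring.
- by rewrite !formE (formC z' p) pz'; ring.
- by rewrite !formE ep; ring.
- by rewrite scalerA tvZ tvC; apply: Ie => //; apply: idealMr.
rewrite tvZ tvC Ez' scalerDr; apply: tv_add.
- by rewrite !formE (formC p e) ep; ring.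
- by rewrite !formE pq; ring.
- by rewrite !formE eq; ring.
- by rewrite scalerA tvZ tvC; apply: Ie => //; apply: idealMr.
exact: perp2_tv.
Qed.

End HyperbolicPair.

Definition contains_tv (e : 'cV[R]_N) : Prop :=
  (forall z, <<e, z>> = 0 -> E (tv e z)) /\
  (forall b z, I b -> <<e, z>> = 0 -> EI (tv e (b *: z))).

Lemma contains_tvN e : contains_tv e -> contains_tv (- e).
Proof.
case=> He HI; have tvNl w : tv (- e) w = tv e (- w) by rewrite -!scaleN1r tvZ.
split=> [z|b z Ib]; rewrite formNl => /eqP; rewrite oppr_eq0 => /eqP ez.
  by rewrite tvNl; apply: He; rewrite formNr ez oppr0.
by rewrite tvNl -scalerN; apply: HI; rewrite ?formNr ?ez ?oppr0.
Qed.

Section Symmetric.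

Variables e f : 'cV[R]_N.
Hypothesis ef : <<e, f>> = 1.
Hypotheses (He : contains_tv e) (Hf : contains_tv f).

Lemma perp_tv_f b z z' : I b -> <<f, z>> = 0 -> <<f, z'>> = 0 ->
  <<z, z'>> = 0 -> EI (tv z (b *: z')).
Proof.
apply: (@perp_tv f (- e)).
- by rewrite formNr formC opprK.
- exact: Hf.1.
- exact: Hf.2.
- exact: (contains_tvN He).2.
Qed.

Lemma tv_scaled u z b : I b -> <<e, z>> = 0 -> <<u, z>> = 0 ->
  EI (tv u ((b * <<e, u>>) *: z)).
Proof.
move=> Ib ez uz; set be := <<e, u>>; set al := <<u, f>>.
pose v := u - al *: e.
have vz : <<v, z>> = 0 by rewrite !formE uz ez; ring.
have zv := formC0 vz.
have fv : <<f, v>> = 0 by rewrite !formE (formC f e) ef (formC f u); rewrite /al; ring.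
have ev : <<e, v>> = be by rewrite !formE formxx; rewrite /be; ring.
have Iz c : EI (tv z ((b * c) *: z)).
  apply: (perp_tv ef He.1 He.2 Hf.2) => //; last exact: formxx.
  exact: idealMr.
have key : EI (tv v ((b * be) *: z)).
  (* The cross term in [tv_square] has coefficient [k + k], which must equal [b]. *)
  pose k := b * h.
  have Ik : I k by apply: idealMr.
  have H0 := perp_tv_f Ik fv fv (formxx v).
  have := nEI (He.1 z ez) H0; rewrite tvJ; last exact: tv_isometry.
  rewrite -scalemxAr !tvE ev zv scale0r subr0 tv_square // -/be -mulrDr halfD mulr1.
  rewrite -mulmxA => /(subgroupMl sEI H0) H1.
  have := subgroupM sEI H1 (subgroupV sEI (Iz (h * be * be))).
  rewrite !mulrA mulmxK; last by apply: tv_unit; rewrite formZr formxx mulr0.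
  rewrite scalerN => /tvN; rewrite opprK; apply.
  by rewrite formNr formZr vz mulr0 oppr0.
(* Pass from [v] back to [u = v + al *: e] with the multiple of [z] as the fixed vector; the
   correction term is then a transvection along [z] alone, covered by [Iz]. *)
rewrite tvC -[u](subrK (al *: e)) -/v; apply: tv_addh.
- by rewrite formZl zv mulr0.
- by rewrite !formE (formC0 ez) !mulr0.
- by rewrite tvC.
- by rewrite tvZ tvC scalerA; apply: He.2 => //; apply: (idealMl hI); apply: (idealMr hI).
by rewrite -tvZ !scalerA mulrC -!mulrA; apply: Iz.
Qed.

End Symmetric.

End NormalPair.

(** * The submodule of vectors absorbed by [u], and its equality with the orthogonal of a unimodular
    [u] *)

Section Unimodular.

Variables (E EI : 'M[R]_N -> Prop) (I : R -> Prop).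
Hypothesis hI : is_ideal I.
Hypotheses (sE : is_subgroup E) (sEI : is_subgroup EI).
Hypothesis nEI : forall g x : 'M_N, E g -> EI x -> EI (g *m x *m invmx g).
Hypothesis isoE : forall g, E g -> isometry g.

(** Membership of [w] in the submodule W attached to [u]; quantifying over all [b] in [I] gives
    closure under scalars. *)
Definition absorbed u w : Prop :=
  <<u, w>> = 0 /\ forall b, I b -> EI (tv u (b *: w)).

Lemma EI_coef a a' u : a = a' -> EI (tv u (a *: u)) -> EI (tv u (a' *: u)).
Proof. by move->. Qed.

Lemma absorbed0 u : absorbed u 0.
Proof.
by split=> [|b _]; rewrite ?form0r // scaler0 tv0; apply: subgroup1.
Qed.

Lemma absorbedZ a u w : absorbed u w -> absorbed u (a *: w).
Proof.
case=> uw H; split=> [|b Ib]; first by rewrite formZr uw mulr0.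
by rewrite scalerA; apply: H; apply: idealMr.
Qed.

Lemma absorbedD u w w' : absorbed u w -> absorbed u w' -> absorbed u (w + w').
Proof.
move=> [uw H] [uw' H']; split=> [|b Ib]; first by rewrite formDr uw uw' addr0.
rewrite scalerDr; apply: tv_addh; rewrite ?formZr ?uw ?uw' ?mulr0 //.
- exact: H.
- exact: H'.
(* The correction required by [tv_addh] is the commutator of [tv u (b *: w)] and
   [tv u ((b * - h) *: w')]. *)
have := subgroupM sEI (subgroupM sEI (subgroupM sEI (H _ Ib) (H' _ (idealMr hI (- h) Ib)))
  (subgroupV sEI (H _ Ib))) (subgroupV sEI (H' _ (idealMr hI (- h) Ib))).
rewrite tv_commutator ?formZr ?uw ?uw' ?mulr0 //.
by apply: EI_coef; rewrite !formE; ring.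
Qed.

Lemma absorbedJ g u w : E g -> absorbed u w -> absorbed (g *m u) (g *m w).
Proof.
move=> Eg [uw H]; split=> [|b Ib]; first by rewrite isometry_form //; apply: isoE.
by rewrite scalemxAr -tvJ; [apply: nEI => //; apply: H | apply: isoE].
Qed.

Section Pair.

Variables e f : 'cV[R]_N.
Hypothesis ef : <<e, f>> = 1.
Hypotheses (He : contains_tv E EI I e) (Hf : contains_tv E EI I f).
Hypothesis full : forall K : R -> Prop, is_ideal K ->
  (forall p q, <<e, p>> = 0 -> <<f, p>> = 0 -> <<e, q>> = 0 -> <<f, q>> = 0 ->
    K <<p, q>>) -> K 1.

Lemma absorbed_scaled u z : <<e, z>> = 0 -> <<u, z>> = 0 -> absorbed u (<<e, u>> *: z).
Proof.
move=> ez uz; split=> [|b Ib]; first by rewrite formZr uz mulr0.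
by rewrite scalerA; apply: (tv_scaled hI sEI nEI ef He Hf).
Qed.

(** This is [tv_scaled] for the pair [E], [E] and the unit ideal. *)
Lemma E_scaled u z : <<e, z>> = 0 -> <<u, z>> = 0 -> E (tv u (<<e, u>> *: z)).
Proof.
move=> ez uz; rewrite -[<<e, u>>]mul1r.
have lift g : contains_tv E EI I g -> contains_tv E E (fun=> True) g.
  case=> H _; split=> // b z' _ gz; apply: H; by rewrite formZr gz mulr0.
apply: (@tv_scaled E E (fun=> True) _ sE _ e f ef (lift _ He) (lift _ Hf)) => //.
by move=> g x Eg Ex; do !apply: (subgroupM sE) => //; apply: subgroupV.
Qed.

(** The multiple of [e] is chosen to make the result orthogonal to [u] without losing orthogonality
    to [e]. *)
Definition shadow u p := <<e, u>> *: p + <<u, p>> *: e.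

Lemma shadow_perp u p : <<e, p>> = 0 -> <<e, shadow u p>> = 0 /\ <<u, shadow u p>> = 0.
Proof.
move=> ep; rewrite /shadow !formE ep formxx (formC u e); split; ring.
Qed.

(** The pairing of the shadows of [p] and [q] is [<<e, u>> ^+ 2 * <<p, q>>], and each of the two
    transvections in the commutator brings one more factor [<<e, u>>]. The pairings [<<p, q>>] are
    then removed by [full]. *)
Lemma absorbed_self u : absorbed u (<<e, u>> ^+ 4 *: u).
Proof.
pose K r := absorbed u ((r * <<e, u>> ^+ 4) *: u).
suff: K 1 by rewrite /K mul1r.
apply: full => [|p q ep _ eq _].
  rewrite /K; split=> [|x y Kx Ky|a x Kx].
  - by rewrite mul0r scale0r; apply: absorbed0.
  - by rewrite mulrDl scalerDl; apply: absorbedD.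
  - by rewrite -mulrA -scalerA; apply: absorbedZ.
have [ezp uzp] := shadow_perp u ep; have [ezq uzq] := shadow_perp u eq.
split=> [|b Ib]; first by rewrite formZr formxx mulr0.
have [uz1 G1] := absorbed_scaled ezp uzp.
have uz2 : <<u, <<e, u>> *: shadow u q>> = 0 by rewrite formZr uzq mulr0.
have := comm_normal sEI nEI (E_scaled ezq uzq) (G1 _ (idealMr hI (-1) Ib)).
rewrite tv_commutator //; last by rewrite formZr uz1 mulr0.
rewrite [b *: _]scalerA; apply: EI_coef.
by rewrite /shadow !formE (formC p e) ep eq formxx; ring.
Qed.

Lemma absorbed_power u w : <<u, w>> = 0 -> absorbed u (<<e, u>> ^+ 5 *: w).
Proof.
move=> uw.
pose p := w - <<e, w>> *: f.
pose y := u - <<u, f>> *: e - <<e, u>> *: f.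
have ep : <<e, p>> = 0 by rewrite !formE ef; ring.
have ey : <<e, y>> = 0 by rewrite !formE formxx ef; ring.
have [ezp uzp] := shadow_perp u ep; have [ezy uzy] := shadow_perp u ey.
(* Write a for [<<e, u>>]. Since [u - y = <<u, f>> *: e + a *: f], the first summand is a^5 [w]
   minus [<<e, w>>] a^4 ([u - y]). As [<<u, y>> = 0], the shadow of [y] is a times [y], so the other
   two summands cancel the excess. *)
have -> : <<e, u>> ^+ 5 *: w = <<e, u>> ^+ 3 *: (<<e, u>> *: shadow u p)
    + <<e, w>> *: (<<e, u>> ^+ 4 *: u)
    - (<<e, w>> * <<e, u>> ^+ 2) *: (<<e, u>> *: shadow u y).
  rewrite /shadow /p /y !formE uw formxx (formC u e).
  by apply/colP => i; rewrite !mxE; ring.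
rewrite -scaleNr; apply: absorbedD; first apply: absorbedD; apply: absorbedZ.
- exact: absorbed_scaled.
- exact: absorbed_self.
- exact: absorbed_scaled.
Qed.

End Pair.

Variables e f : 'cV[R]_N.
Hypothesis ef : <<e, f>> = 1.
Hypotheses (He : contains_tv E EI I e) (Hf : contains_tv E EI I f).
Hypothesis full : forall K : R -> Prop, is_ideal K ->
  (forall p q, <<e, p>> = 0 -> <<f, p>> = 0 -> <<e, q>> = 0 -> <<f, q>> = 0 ->
    K <<p, q>>) -> K 1.

(** The multipliers [r] carrying the whole orthogonal of [u] into W form an ideal [J]; it contains
    powers of the three pairings into which [<<u', u>> = 1] decomposes. *)
Lemma absorbed_unimodular u u' w : <<u', u>> = 1 -> <<u, w>> = 0 -> absorbed u w.
Proof.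
move=> u'u uw.
pose J r := forall w, <<u, w>> = 0 -> absorbed u (r *: w).
have iJ : is_ideal J.
  split=> [x _|x y Jx Jy v uv|a x Jx v uv].
  - by rewrite scale0r; apply: absorbed0.
  - by rewrite scalerDl; apply: absorbedD; [apply: Jx | apply: Jy].
  - by rewrite -scalerA; apply/absorbedZ/Jx.
have Je : J (<<e, u>> ^+ 5) by move=> v; apply: absorbed_power ef He Hf full _ _.
have Jf : J (<<f, u>> ^+ 5).
  move=> v; apply: (absorbed_power _ Hf (contains_tvN He)) => [|K iK HK].
    by rewrite formNr formC opprK.
  apply: full => // p q ep fp eq fq; apply: HK; rewrite ?formNl ?ep ?eq ?oppr0 //.
have Jp p : <<e, p>> = 0 -> <<f, p>> = 0 -> J (<<p, u>> ^+ 10).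
  move=> ep fp.
  (* The element [tv f (- p)] of [E] sends [e] to [e - p], so [absorbed_power] for [e] is applied to
     the preimages of [u] and [v] and carried back by [absorbedJ]. *)
  have Jep : J (<<e - p, u>> ^+ 5).
    move=> v uv; have fNp : <<f, - p>> = 0 by rewrite formNr fp oppr0.
    pose g := tv f (- p).
    have Eg : E g by apply: Hf.1.
    have gI := isoE Eg; have [gu _] := gI.
    have ge : g *m e = e - p.
      rewrite tvE (formC f e) ef formNl (formC p e) ep.
      by apply/colP => i; rewrite !mxE; ring.
    have Kmul x : g *m (invmx g *m x) = x by rewrite mulKVmx.
    rewrite -[u]Kmul -[v]Kmul scalemxAr; apply: absorbedJ => //.
    rewrite -ge isometry_form //.
    apply: (absorbed_power ef He Hf full).
    by rewrite -(isometry_form _ _ gI) !Kmul.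
  have -> : <<p, u>> = <<e, u>> + - 1 * <<e - p, u>> by rewrite !formE; ring.
  rewrite -[10%N]/(5 + 5)%N; apply: (idealXD iJ) => //.
  by rewrite exprMn; apply: (idealMl iJ).
have [p [u'E ep fp]] := hyperbolic_decomp ef u'.
(* The exponents belong to [<<e, u>>], [<<f, u>>] and [<<p, u>>], in this order. *)
have J1 : J (1 ^+ (5 + 5 + 10)).
  rewrite -u'u u'E !formE; apply: (idealXD iJ); last exact: Jp.
  by apply: (idealXD iJ); rewrite exprMn; apply: (idealMl iJ).
by rewrite expr1n in J1; rewrite -[w]scale1r; apply: J1.
Qed.

Lemma tv_unimodular u u' w : <<u', u>> = 1 -> <<u, w>> = 0 ->
  (forall i, I (w i 0)) -> EI (tv u w).
Proof.
move=> u'u uw Iw.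
(* Projection of the standard basis vectors to the orthogonal of [u] along [u']; the coordinates of
   [w] with respect to the [z i] are still its entries, hence in [I]. *)
pose z i : 'cV[R]_N := delta_mx i 0 + <<u, delta_mx i 0>> *: u'.
have uz i : <<u, z i>> = 0 by rewrite !formE (formC u u') u'u; ring.
have wE : w = \sum_i w i 0 *: z i.
  have w_delta : w = \sum_i w i 0 *: delta_mx i 0.
    apply/colP => i; rewrite summxE (bigD1 i) //= big1 => [|j ji].
      by rewrite !mxE !eqxx mulr1 addr0.
    by rewrite !mxE eq_sym (negbTE ji) mulr0.
  rewrite (eq_bigr _ (fun i _ => scalerDr _ _ _)) big_split /= -w_delta.
  rewrite [X in w + X](_ : _ = <<u, w>> *: u'); first by rewrite uw scale0r addr0.
  rewrite [in RHS]w_delta form_sumr scaler_suml; apply: eq_bigr => i _.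
  by rewrite scalerA formZr.
have EIs a v : I a -> <<u, v>> = 0 -> EI (tv u (a *: v)).
  by move=> Ia uv; apply: (absorbed_unimodular u'u uv).2.
(* The middle condition keeps the correction coefficient of [tv_addh] in [I] during the
   summation. *)
pose Q v := [/\ <<u, v>> = 0, forall y, I <<y, v>> & EI (tv u v)].
rewrite wE; suff: Q (\sum_i w i 0 *: z i) by case.
apply: big_ind => [|x y [ux Ix Ex] [uy Iy Ey]|i _].
- split=> [|y|]; rewrite ?form0r //; first exact: ideal0.
  by rewrite tv0; apply: subgroup1.
- split=> [|v|]; first by rewrite formDr ux uy addr0.
    by rewrite formDr; apply: idealD.
  apply: tv_addh => //; apply: EIs; last exact: formxx.
  exact: idealMl.
- split=> [|y|]; first by rewrite formZr uz mulr0.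
    by rewrite formZr; apply: idealMr.
  exact: EIs.
Qed.

End Unimodular.

End Transvections.

(** * The groups Sp, ESp and their generators *)

Section Elementary.

Variables (R : comUnitRingType) (m : nat) (phi : 'M[R]_(1 + m)).
Hypothesis h2 : (2%:R : R) \is a GRing.unit.
Hypothesis skew : phi^T = - phi.
Hypothesis phi_unit : phi \in unitmx.

Local Notation form := (pairing phi).
Local Notation tv := (tv phi).
Local Notation h := (2%:R^-1 : R).
Local Notation c := (phi_c phi).
Local Notation d := (phi_d phi).
Local Notation nu := (phi_nu phi).
Local Notation mu := (phi_mu phi).

Definition hyp_e : 'cV[R]_(1 + m) := col_mx 1%:M 0.
Definition hyp_f : 'cV[R]_(1 + m) := invmx phi *m hyp_e.
Local Notation e := hyp_e.
Local Notation f := hyp_f.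

Definition dot (x y : 'cV[R]_m) : R := (x^T *m y) 0 0.

Lemma dotE x y : x^T *m y = (dot x y)%:M.
Proof. exact: mx11_scalar. Qed.

Lemma dotC x y : dot x y = dot y x.
Proof.
by rewrite /dot -[y^T *m x]trmxK trmx_mul trmxK [RHS]mxE.
Qed.

Lemma col_decomp (x : 'cV[R]_(1 + m)) : exists a x1, x = col_mx (a%:M : 'M_1) x1.
Proof.
by exists (usubmx x 0 0), (dsubmx x); rewrite -mx11_scalar vsubmxK.
Qed.

Lemma phi_block : phi = block_mx 0 (- c^T) c nu.
Proof.
rewrite -[LHS]submxK; congr block_mx.
  rewrite [LHS]mx11_scalar [RHS]mx11_scalar !mxE; congr (_%:M).
  have := formxx h2 skew (delta_mx (lshift m 0) 0).
  by rewrite /pairing trmx_delta -rowE -colE !mxE.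
by rewrite /phi_c trmx_dlsub skew; apply/matrixP => i j; rewrite !mxE opprK.
Qed.

Lemma invmx_skew : (invmx phi)^T = - invmx phi.
Proof.
have pT : phi^T \in unitmx by rewrite unitmx_tr.
apply: (can_inj (mulKmx pT)); rewrite -trmx_mul mulVmx // trmx1.
by rewrite skew mulmxN mulNmx opprK mulmxV.
Qed.

Lemma form_e x : form e x = usubmx (phi *m x) 0 0.
Proof.
rewrite /pairing /e tr_col_mx trmx1 trmx0 -mulmxA -[phi *m x]vsubmxK mul_row_col.
by rewrite mul1mx mul0mx addr0 col_mxKu.
Qed.

Lemma form_inv v x : form (invmx phi *m v) x = - (v^T *m x) 0 0.
Proof.
by rewrite /pairing trmx_mul invmx_skew mulmxN !mulNmx mxE mulmxKV.
Qed.

Lemma form_f a x : form f (col_mx a%:M x) = - a.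
Proof.
rewrite form_inv /e tr_col_mx trmx1 trmx0 mul_row_col mul1mx mul0mx addr0.
by rewrite !mxE eqxx.
Qed.

Lemma form_ef : form e f = 1.
Proof. by rewrite form_e mulKVmx // col_mxKu mxE. Qed.

Lemma form_e_col a x : form e (col_mx a%:M x) = - dot c x.
Proof.
by rewrite form_e [X in X *m _]phi_block mul_block_col mul0mx add0r mulNmx dotE
  col_mxKu !mxE eqxx mulr1n.
Qed.

Lemma f_col : f = col_mx 0 (- d).
Proof.
have [a [x fE]] := col_decomp f.
have a0 : a = 0.
  by have := formxx h2 skew f; rewrite {2}fE form_f => /eqP; rewrite oppr_eq0 => /eqP.
rewrite fE a0 -scalemx1 scale0r; congr col_mx.
have -> : x = dsubmx f by rewrite fE col_mxKd.
rewrite /f /e -[invmx phi in LHS]submxK mul_block_col col_mxKd !mulmx0 mulmx1 addr0.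
by rewrite /phi_d opprK.
Qed.

Lemma invmx_block : invmx phi = block_mx 0 d^T (- d) mu.
Proof.
have fE := f_col.
rewrite /f /e -[invmx phi in LHS]submxK mul_block_col !mulmx0 !mulmx1 !addr0 in fE.
have [ul dl] := eq_col_mx fE.
rewrite -[LHS]submxK ul dl; congr block_mx.
rewrite /phi_d linearN /= trmx_dlsub invmx_skew.
by apply/matrixP => i j; rewrite !mxE opprK.
Qed.

(* Modulo an ideal K containing all <p, q> with p, q orthogonal to e and f, the
   identity matrix of size m > 1 is the rank one matrix [d *m c^T]. *)
Lemma hyp_full : (1 < m)%N -> forall K : R -> Prop, is_ideal K ->
  (forall p q, form e p = 0 -> form f p = 0 -> form e q = 0 -> form f q = 0 ->
    K (form p q)) -> K 1.
Proof.
move=> m2 K iK HK.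
have entry i j : K ((i == j)%:R - c j 0 * d i 0).
  pose x : 'cV[R]_(1 + m) := col_mx (0%:M) (delta_mx j 0).
  pose y := invmx phi *m - (col_mx 0 (delta_mx i 0) : 'cV[R]_(1 + m)).
  have [p [xE ep fp]] := hyperbolic_decomp h2 skew form_ef x.
  have [q [yE eq fq]] := hyperbolic_decomp h2 skew form_ef y.
  have := HK q p eq fq ep fp.
  have <- : form y p = form q p.
    by rewrite yE !(formDl skew) !(formZl skew) ep fp; ring.
  have -> : p = x - form x f *: e - form e x *: f.
    by rewrite {1}xE; apply/colP => k; rewrite !mxE; ring.
  rewrite !form_inv /x form_e_col f_col /e [(- _)^T]linearN /= tr_col_mx trmx0 mulNmx.
  rewrite !(scale_col_mx, opp_col_mx, add_col_mx).
  rewrite mul_row_col mul0mx add0r trmx_delta -rowE !mxE opprK eqxx andbT.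
  have -> : dot c (delta_mx j 0) = c j 0 by rewrite /dot -colE !mxE.
  by congr K; rewrite !mxE; ring.
pose i0 : 'I_m := Ordinal (ltnW m2); pose i1 : 'I_m := Ordinal m2.
have K0 := entry i0 i0; have K1 := entry i1 i1; have K01 := entry i0 i1.
rewrite eqxx /= in K0; rewrite eqxx /= in K1; rewrite /= in K01.
(* The 2 by 2 minor of the rank one matrix vanishes, so the same minor of the identity is a
   combination of entries in [K]. *)
have -> : 1 = (1%:R - c i0 0 * d i0 0) + c i0 0 * d i0 0 * (1%:R - c i1 0 * d i1 0)
   + - (c i0 0 * d i1 0) * (0%:R - c i1 0 * d i0 0) :> R by ring.
apply: (idealD iK); last exact: (idealMl iK).
by apply: (idealD iK) => //; apply: (idealMl iK).
Qed.

(** The multiple of [f] enters [tv] in both rank one terms, so half of [dot c v] cancels the pairing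
    of [col_mx 0 v] with [e] and leaves [v] below the corner entry. *)
Lemma C_mxE v : C_mx phi v = tv f (col_mx 0 v + (h * dot c v) *: f).
Proof.
apply: mx_ext => x; have [a [x1 ->]] := col_decomp x.
rewrite tvE form_f (formDl skew) (formZl skew) form_f.
have -> : form (col_mx 0 v) (col_mx a%:M x1) = dot c v * a + (v^T *m nu *m x1) 0 0.
  rewrite /pairing tr_col_mx trmx0 -mulmxA [X in _ *m (X *m _)]phi_block mul_block_col.
  rewrite mul_row_col mul0mx !add0r mulmxDr mul_mx_scalar -scalemxAr dotE.
  by rewrite mulmxA mxE [X in X + _]mxE [X in a * X]mxE eqxx mulr1n dotC mulrC.
rewrite /C_mx mul_block_col mul0mx mul1mx addr0 /alpha_mx mulmxDl mul1mx.
rewrite !mul_mx_scalar -2!mulmxA (mulmxA v^T) [X in d *m X]mx11_scalar mul_mx_scalar.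
rewrite f_col !(scale_col_mx, opp_col_mx, add_col_mx); congr col_mx.
  by rewrite !(scaler0, addr0, subr0).
set z := (v^T *m nu *m x1) 0 0; move: z => z; apply/colP => i; rewrite !mxE.
by move: (h * _) (half_split h2 (dot c v)) => t ->; ring.
Qed.

Lemma R_mxE v : R_mx phi v =
  tv e (invmx phi *m col_mx 0 v - (h * dot d v) *: e).
Proof.
apply: mx_ext => x; have [a [x1 ->]] := col_decomp x.
rewrite tvE form_e_col (formDl skew) (formNl skew) (formZl skew) form_e_col form_inv.
rewrite tr_col_mx trmx0 mul_row_col mul0mx add0r -/(dot v x1).
rewrite /R_mx invmx_block !mul_block_col !mul0mx !mulmx0 !add0r mul1mx /beta_mx.
rewrite mulmxDl mul1mx.
rewrite -2!mulmxA !dotE !mul_mx_scalar -scalemxAr.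
rewrite !(scale_col_mx, opp_col_mx, add_col_mx); congr col_mx.
  apply/colP => i; rewrite !mxE (ord1 i) eqxx !mulr1n.
  by move: (h * _) (half_split h2 (dot d v)) => t ->; ring.
by apply/colP => i; rewrite !mxE; ring.
Qed.

Lemma mx11_0 : 0 = (0 : R)%:M :> 'M_1.
Proof. by rewrite -scalemx1 scale0r. Qed.

Lemma dotDr x y z : dot x (y + z) = dot x y + dot x z.
Proof. by rewrite /dot mulmxDr mxE. Qed.

Lemma dotZr a x y : dot x (a *: y) = a * dot x y.
Proof. by rewrite /dot -scalemxAr mxE. Qed.

Lemma dot_cd : dot c d = 1.
Proof.
have := form_ef; rewrite f_col mx11_0.
by rewrite form_e_col -scaleN1r dotZr mulN1r opprK.
Qed.

Lemma phi_e : phi *m e = col_mx 0 c.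
Proof. by rewrite [X in X *m _]phi_block mul_block_col !mulmx0 !mulmx1 !addr0. Qed.

Lemma half_double a : h * (a + a) = a.
Proof. by rewrite mulrDr -mulrDl halfD ?mul1r. Qed.

Lemma ideal_mulmx (I : R -> Prop) p q (A : 'M[R]_(p, q)) (x : 'cV_q) :
  is_ideal I -> (forall i, I (x i 0)) -> forall i, I ((A *m x) i 0).
Proof.
by move=> hI Ix i; rewrite mxE; apply: ideal_sum => // j; apply: idealMl.
Qed.

(** Solves [R_mxE] for [v]: as [dot c d = 1], [dot d v] is twice [dot d o], and the half undoes the
    doubling. The top entry of [phi *m w] is [form e w], which vanishes. *)
Lemma tv_e_R w : form e w = 0 -> exists2 v, tv e w = R_mx phi v &
  forall I, is_ideal I -> (forall i, I (w i 0)) -> forall i, I (v i 0).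
Proof.
move=> ew; set o := dsubmx (phi *m w); exists (o + dot d o *: c).
  rewrite R_mxE; congr tv.
  rewrite dotDr dotZr (dotC d c) dot_cd mulr1 half_double.
  have -> : col_mx 0 (o + dot d o *: c) = phi *m w + dot d o *: (phi *m e).
    rewrite phi_e scale_col_mx scaler0 -[phi *m w]vsubmxK add_col_mx addr0.
    congr col_mx; rewrite [RHS]mx11_scalar -form_e ew.
    exact: mx11_0.
  by rewrite mulmxDr -scalemxAr !mulKmx // addrK.
move=> I hI Iw; have Io i : I (o i 0).
  by rewrite /o mxE; apply: ideal_mulmx.
move=> i; rewrite mxE [X in _ + X]mxE; apply: idealD => //; apply: idealMr => //.
exact: ideal_mulmx.
Qed.

Lemma tv_f_C w : form f w = 0 -> exists2 v, tv f w = C_mx phi v &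
  forall I, is_ideal I -> (forall i, I (w i 0)) -> forall i, I (v i 0).
Proof.
have [a [o ->]] := col_decomp w.
rewrite form_f => /eqP; rewrite oppr_eq0 => /eqP ->; exists (o + dot c o *: d).
  rewrite C_mxE dotDr dotZr dot_cd mulr1 half_double f_col; congr tv.
  rewrite scale_col_mx scaler0 add_col_mx addr0 (scalerN _ d) addrK.
  by rewrite -mx11_0.
move=> I hI Iw; have Io i : I (o i 0).
  by have := Iw (rshift 1 i); rewrite col_mxEd.
move=> i; rewrite mxE [X in _ + X]mxE; apply: idealD => //; apply: idealMr => //.
exact: ideal_mulmx.
Qed.

Lemma elem_gen_tv (I : R -> Prop) x : is_ideal I -> elem_gen phi I x ->
  exists u w, [/\ x = tv u w, u = e \/ u = f, form u w = 0
    & forall i, I (w i 0)].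
Proof.
move=> hI [v Iv [->|->]].
  exists f, (col_mx 0 v + (h * dot c v) *: f); split; [exact: C_mxE|by right| |].
    by rewrite formDr formZr (formxx h2 skew) mulr0 addr0 mx11_0 form_f oppr0.
  move=> i; rewrite mxE; apply: idealD => //.
    rewrite -[i]splitK; case: (split i) => j; last by rewrite col_mxEd.
    by rewrite col_mxEu mxE; apply: ideal0.
  rewrite mxE; apply: idealMr => //; apply: idealMl => //; exact: ideal_mulmx.
exists e, (invmx phi *m col_mx 0 v - (h * dot d v) *: e).
split; [exact: R_mxE|by left| |].
  rewrite formDr formNr formZr (formxx h2 skew) mulr0 subr0.
  by rewrite form_e mulKVmx // col_mxKu mxE.
have I0v i : I ((col_mx 0 v : 'cV_(1 + m)) i 0).
  rewrite -[i]splitK; case: (split i) => j; last by rewrite col_mxEd.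
  by rewrite col_mxEu mxE; apply: ideal0.
move=> i; rewrite mxE; apply: idealD => //; first exact: ideal_mulmx.
rewrite -scaleNr mxE; apply: idealMr => //; rewrite -mulrN; apply: idealMl => //.
by rewrite -mulN1r; apply: idealMl => //; apply: ideal_mulmx.
Qed.

Lemma elem_gen_Sp (I : R -> Prop) x : is_ideal I -> elem_gen phi I x -> Sp phi x.
Proof.
move=> hI /(elem_gen_tv hI) [u [w [-> _ uw _]]]; exact: tv_isometry.
Qed.

Lemma ideal_full : is_ideal (fun _ : R => True). Proof. by []. Qed.

Lemma Sp_subgroup : is_subgroup (Sp phi). Proof. exact: isometry_subgroup. Qed.

Lemma ESp_full_subgroup : is_subgroup (ESp_full phi).
Proof.
apply: generated_subgroup Sp_subgroup _ => x; exact: elem_gen_Sp ideal_full.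
Qed.

Lemma ESp_gen (I : R -> Prop) x : elem_gen phi I x -> ESp phi I x.
Proof. by move=> Gx H _; apply. Qed.

Lemma ESp_Sp x : ESp_full phi x -> Sp phi x.
Proof. by apply=> [|y]; [exact: Sp_subgroup | exact: elem_gen_Sp ideal_full]. Qed.

Lemma ESp_sub_full (I : R -> Prop) x : ESp phi I x -> ESp_full phi x.
Proof.
apply=> [|y [v _ vE]]; first exact: ESp_full_subgroup.
by apply: ESp_gen; exists v.
Qed.

(** * Conjugates of elementary generators under the full symplectic group *)

Section ConjugateGenerators.

Variables (I : R -> Prop) (EI : 'M[R]_(1 + m) -> Prop).
Hypothesis m2 : (1 < m)%N.
Hypotheses (hI : is_ideal I) (sEI : is_subgroup EI).
Hypothesis nEI : forall g x : 'M_(1 + m),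
  ESp_full phi g -> EI x -> EI (g *m x *m invmx g).
Hypothesis genEI : forall x, elem_gen phi I x -> EI x.

Lemma contains_tv_pair u : u = e \/ u = f -> contains_tv phi (ESp_full phi) EI I u.
Proof.
move=> ueqf; have key w : form u w = 0 ->
    exists2 v, tv u w = C_mx phi v \/ tv u w = R_mx phi v &
    forall I, is_ideal I -> (forall i, I (w i 0)) -> forall i, I (v i 0).
  case: ueqf => -> => [/tv_e_R | /tv_f_C] [v vE Iv]; exists v => //; by [right | left].
split=> [w uw|b w Ib uw].
  have [v vE _] := key _ uw; apply: ESp_gen; by exists v.
have [|v vE Iv] := key (b *: w); first by rewrite formZr uw mulr0.
by apply: genEI; exists v => //; apply: Iv => // i; rewrite mxE; apply: idealMr.
Qed.

(** The conjugate is the transvection with vectors [g *m u] and [g *m w]; the former is again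
    unimodular and the latter again has entries in [I]. *)
Lemma conj_elem_gen g x : Sp phi g -> elem_gen phi I x ->
  EI (g *m x *m invmx g).
Proof.
move=> gS /(elem_gen_tv hI) [u [w [-> ueqf uw Iw]]].
have gI : isometry phi g := gS.
rewrite tvJ //.
have [u' u'u] : exists u', form u' u = 1.
  case: ueqf => ->; last by exists e; apply: form_ef.
  by exists (- f); rewrite formNl // formC // opprK form_ef.
apply: (tv_unimodular h2 skew hI ESp_full_subgroup sEI nEI ESp_Sp form_ef
  _ _ (hyp_full m2) (u' := g *m u')).
- by apply: contains_tv_pair; left.
- by apply: contains_tv_pair; right.
- by rewrite (isometry_form _ _ gI).
- by rewrite (isometry_form _ _ gI).
exact: ideal_mulmx.
Qed.

End ConjugateGenerators.

Lemma ESp_rel_normal (I : R -> Prop) : (1 < m)%N -> is_ideal I ->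
  is_normal_subgroup (ESp_rel phi I) (Sp phi).
Proof.
move=> m2 hI; have sE := ESp_full_subgroup.
have [_ sEI EI_E nEI] : is_normal_subgroup (ESp_rel phi I) (ESp_full phi).
  apply: normal_closure_normal => // x; exact: ESp_sub_full.
(* The case of the unit ideal with [EI] equal to [ESp_full phi]. *)
have conjE g x : Sp phi g -> ESp_full phi x -> ESp_full phi (g *m x *m invmx g).
  move=> gS Ex; apply: (Ex (fun x => ESp_full phi (g *m x *m invmx g))).
    exact: conj_subgroup gS.1 sE.
  move=> y Gy; apply: (conj_elem_gen m2 ideal_full sE _ _ gS Gy).
    by have [] := subgroup_normal sE.
  by move=> z Gz; apply: ESp_gen.
split=> //; first exact: Sp_subgroup.
  by move=> x /EI_E /ESp_Sp.
move=> g x gS Ex; have [gu _] := gS.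
have gen_rel y : ESp phi I y -> ESp_rel phi I y by move=> Ey H _; apply.
(* A competitor in the definition of the normal closure: it is normal in [ESp_full phi] and contains
   [ESp phi I]. *)
pose H y := ESp_full phi y /\ ESp_rel phi I (g *m y *m invmx g).
suff [] : H x by [].
have sC := conj_subgroup gu sEI.
apply: Ex => [|y Ey]; last first.
  split; first exact: ESp_sub_full Ey.
  apply: (Ey (fun x => ESp_rel phi I (g *m x *m invmx g))) => // z Gz.
  apply: (conj_elem_gen m2 hI sEI nEI _ gS Gz) => t Gt.
  by apply: gen_rel; apply: ESp_gen.
split=> //; last first.
- move=> k y Ek [Ey Hy]; split.
    by have [_ _ _] := subgroup_normal sE; apply.
  have ku := (ESp_Sp Ek).1.
  (* Conjugating [k y k^-1] by [g] amounts to conjugating [g y g^-1] by [g k g^-1], which lies in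
     [ESp_full phi] by [conjE]. *)
  have := nEI _ _ (conjE _ _ gS Ek) Hy.
  by rewrite invmx_conj // !mulmxA !mulmxKV.
- by move=> y [].
split=> [y [/(subgroup_unit sE)]||y z [Ey Hy] [Ez Hz]|y [Ey Hy]] //.
- by split; [apply: (subgroup1 sE) | apply: (subgroup1 sC)].
- by split; [apply: (subgroupM sE) | apply: (subgroupM sC)].
- by split; [apply: (subgroupV sE) | apply: (subgroupV sC)].
Qed.

End Elementary.

(** * Pfaffians *)

Section Matchings.

Variable N : nat.
Hypothesis N_even : ~~ odd N.
Implicit Types (i j k : 'I_N) (s t u : 'S_N).

(** The default of [insubd] is never reached because [N] is even. *)
Definition mate_fun i : 'I_N := insubd i (if odd i then i.-1 else i.+1).

Lemma mate_funE i : mate_fun i = (if odd i then i.-1 else i.+1) :> nat.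
Proof.
rewrite val_insubd; case: ifP => // /negP[].
by have := ltn_ord i; move: N_even; case: ifP; lia.
Qed.

Lemma mate_funK : involutive mate_fun.
Proof.
by move=> i; apply: val_inj; rewrite /= !mate_funE; case: (boolP (odd i)); case: ifP; lia.
Qed.

Definition mate : 'S_N := perm (inv_inj mate_funK).

Lemma mateE i : mate i = (if odd i then i.-1 else i.+1) :> nat.
Proof. by rewrite permE mate_funE. Qed.

Lemma mateK : involutive mate.
Proof. by move=> i; rewrite !permE mate_funK. Qed.

Lemma odd_mate i : odd (mate i) = ~~ odd i.
Proof. by rewrite mateE; case: ifP; lia. Qed.

Lemma mate_neq i : mate i != i.
Proof. by apply/eqP => E; have := odd_mate i; rewrite E; case: odd. Qed.

Lemma mate_even i j : ~~ odd i -> (j == i.+1 :> nat) = (j == mate i).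
Proof. by move=> ei; rewrite -val_eqE /= mateE (negbTE ei). Qed.

Lemma matchingP s : reflect
  ((forall i, ~~ odd i -> (s i < s (mate i))%N) /\
   (forall i j, ~~ odd i -> ~~ odd j -> (i < j)%N -> (s i < s j)%N))
  (matching_perm s).
Proof.
apply: (iffP andP) => [[/forallP H1 /forallP H2]|[H1 H2]]; split.
- move=> i ei; have /forallP/(_ (mate i))/implyP := H1 i; apply.
  by rewrite ei mate_even ?eqxx.
- by move=> i j ei ej ij; have /forallP/(_ j)/implyP := H2 i; apply; rewrite ei ej.
- apply/forallP => i; apply/forallP => j; apply/implyP => /andP[ei].
  by rewrite mate_even // => /eqP ->; apply: H1.
- by apply/forallP => i; apply/forallP => j; apply/implyP => /and3P[*]; apply: H2.
Qed.

Lemma incr_perm_id s : (forall i j, (i < j)%N -> (s i < s j)%N) -> s = 1%g.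
Proof.
have ge t : (forall i j, (i < j)%N -> (t i < t j)%N) -> forall i, (i <= t i)%N.
  move=> mono [i]; elim: i => // i IH lt_i.
  exact: leq_ltn_trans (IH (ltnW lt_i)) (mono (Ordinal (ltnW lt_i)) _ _).
move=> mono; have geV : forall i, (i <= (s^-1)%g i)%N.
  apply: ge => i j ij; rewrite ltnNge; apply/negP; rewrite leq_eqVlt.
  case/orP => [/eqP/val_inj/perm_inj ji|/mono]; first by move: ij; rewrite ji ltnn.
  by rewrite !permKV; lia.
apply/permP => i; apply: val_inj; rewrite perm1 /=; apply/eqP.
rewrite eqn_leq ge // andbT.
by have := geV (s i); rewrite permK.
Qed.

(* [mate ^ s] is the involution exchanging [s 0] with [s 1], [s 2] with [s 3], ... *)
Lemma matching_uniq s t : matching_perm s -> matching_perm t ->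
  (mate ^ s = mate ^ t)%g -> s = t.
Proof.
move=> /matchingP[s1 s2] /matchingP[t1 t2] st.
pose h : 'S_N := (t * s^-1)%g.
have hE x : t x = s (h x) by rewrite permM permKV.
have hC x : h (mate x) = mate (h x).
  have : (mate ^ h = mate)%g by rewrite conjgM -st -conjgM mulgV conjg1.
  by move/conjg_fixP/commgP/permP/(_ x); rewrite !permM => ->.
have par (r : 'S_N) : (forall i, ~~ odd i -> (r i < r (mate i))%N) ->
    forall x : 'I_N, (r x < r (mate x))%N = ~~ odd x.
  move=> r1 x; case: (boolP (odd x)) => ox; last by rewrite r1.
  by apply/negbTE; have := r1 (mate x); rewrite odd_mate ox mateK => /(_ isT); lia.
have hodd x : odd (h x) = odd x.
  by apply: negb_inj; rewrite -(par s s1) -(par t t1) !hE hC.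
have heven i j : ~~ odd i -> ~~ odd j -> (i < j)%N -> (h i < h j)%N.
  move=> ei ej ij; have := t2 _ _ ei ej ij; rewrite !hE ltnNge => sij.
  rewrite ltnNge; apply: contra sij; rewrite leq_eqVlt => /orP[/eqP/val_inj -> //|].
  by move=> ji; apply/ltnW/s2; rewrite ?hodd.
have base (x : 'I_N) : exists y : 'I_N, [/\ ~~ odd y, x = (y + odd x)%N :> nat
    & h x = (h y + odd x)%N :> nat].
  case: (boolP (odd x)) => ox; last by exists x; rewrite !addn0.
  exists (mate x); rewrite odd_mate ox; split=> //; first by rewrite mateE ox; lia.
  by rewrite hC mateE hodd ox; have := hodd x; lia.
suff h1 : h = 1%g by apply/permP => x; rewrite hE h1 perm1.
apply: incr_perm_id => i j.
have [y [ey -> ->]] := base i; have [z [ez -> ->]] := base j => ij.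
have [yz|zy|/val_inj yz] := ltngtP y z.
- by have := heven _ _ ey ez yz; have := hodd y; have := hodd z; lia.
- by lia.
- by move: ij; rewrite yz; lia.
Qed.

Definition swap i : 'S_N := tperm i (mate i).
Definition exchange i j : 'S_N := (tperm i j * tperm (mate i) (mate j))%g.

Lemma swap_mate i : (mate ^ swap i = mate)%g.
Proof.
apply/conjg_fixP/commgP/commute_sym/commgP/conjg_fixP.
by rewrite tpermJ mateK tpermC.
Qed.

Lemma exchange_mate i j : ~~ odd i -> ~~ odd j -> (mate ^ exchange i j = mate)%g.
Proof.
move=> ei ej; apply/conjg_fixP/commgP/commute_sym/commgP/conjg_fixP.
rewrite conjMg !tpermJ !mateK; apply/commgP/conjg_fixP.
have D (x y : 'I_N) : ~~ odd x -> ~~ odd y -> mate x != y.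
  by move=> ex ey; apply/eqP => E; move: ey; rewrite -E odd_mate (negbTE ex).
by rewrite tpermJ !tpermD // eq_sym D.
Qed.

(* Decreases when two entries violating [matching_perm] are put in order, so that
   every matching is represented by some [matching_perm]. *)
Definition potential s := (\sum_(i < N | ~~ odd i) (N - i) * s i)%N.

Lemma swap_potential i s : ~~ odd i -> (s (mate i) < s i)%N ->
  (potential (swap i * s) < potential s)%N.
Proof.
move=> ei lt_s; rewrite /potential (bigD1 i) //= [X in (_ < X)%N](bigD1 i) //=.
rewrite permM tpermL -addSn leq_add //; first by rewrite ltn_mul2l subn_gt0 ltn_ord.
apply: leq_sum => j /andP[ej ji]; rewrite permM tpermD // eq_sym //.
by apply/eqP => E; move: ej; rewrite E odd_mate ei.
Qed.

Lemma exchange_even i j (x : 'I_N) : ~~ odd i -> ~~ odd j -> ~~ odd x ->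
  exchange i j x = tperm i j x.
Proof.
move=> ei ej ex; have ey : ~~ odd (tperm i j x) by case: tpermP.
rewrite permM [tperm (mate i) _ _]tpermD //;
  by apply/eqP => E; move: ey; rewrite -E odd_mate ?ei ?ej.
Qed.

(** Rearrangement inequality: after the exchange the larger weight [N - i] meets the smaller
    value. *)
Lemma exchange_potential i j s : ~~ odd i -> ~~ odd j -> (i < j)%N ->
  (s j < s i)%N -> (potential (exchange i j * s) < potential s)%N.
Proof.
move=> ei ej ij lt_s.
have ji : j != i by apply: contraTneq ij => ->; rewrite ltnn.
rewrite /potential (bigD1 i) //= (bigD1 j) ?ej //=.
rewrite [X in (_ < X)%N](bigD1 i) //= [X in (_ < _ + X)%N](bigD1 j) ?ej //=.
rewrite !(permM (exchange i j) s) !exchange_even // tpermL tpermR.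
rewrite !addnA -addSn leq_add //.
  have := ltn_ord i; have := ltn_ord j; nia.
apply: leq_sum => k /andP[/andP[ek ki] kj].
by rewrite (permM (exchange i j) s) exchange_even // tpermD // eq_sym.
Qed.

(** * Pfaffian terms, relabelling of indices, and expansion along a row *)

Section Terms.

Variable R : comUnitRingType.
Implicit Types A : 'M[R]_N.

Definition pf_term A s : R :=
  (-1) ^+ s * \prod_(i < N | ~~ odd i) A (s i) (s (mate i)).

Lemma pfaffianE A : pfaffian A = \sum_(s | matching_perm s) pf_term A s.
Proof.
apply: eq_bigr => s _; congr (_ * _); apply: eq_bigr => i ei.
by apply: big_pred1 => j; rewrite /= mate_even.
Qed.

Lemma skew_entry A i j : A^T = - A -> A i j = - A j i.
Proof. by move/matrixP/(_ j i); rewrite !mxE. Qed.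

(** The sign of the transposition cancels that of the one factor whose indices are interchanged. *)
Lemma swap_term A i s : A^T = - A -> ~~ odd i ->
  pf_term A (swap i * s) = pf_term A s.
Proof.
move=> sA ei; rewrite /pf_term odd_permM odd_tperm eq_sym mate_neq /= signrN.
rewrite (bigD1 i) //= [in RHS](bigD1 i) //= !permM tpermL tpermR skew_entry //.
rewrite 2!mulNr mulrN opprK; congr (_ * (_ * _)); apply: eq_bigr => j /andP[ej ji].
have D (x : 'I_N) : x != i -> x != mate i -> swap i x = x.
  by move=> xi xm; rewrite tpermD // eq_sym.
have jm : j != mate i by apply/eqP => E; move: ej; rewrite E odd_mate ei.
rewrite !permM [swap i j]D // [swap i (mate j)]D //; last by rewrite (can_eq mateK).
by rewrite (can2_eq mateK mateK).
Qed.

Lemma exchange_term A i j s : ~~ odd i -> ~~ odd j ->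
  pf_term A (exchange i j * s) = pf_term A s.
Proof.
move=> ei ej; rewrite /pf_term !odd_permM !odd_tperm (can_eq mateK) addbb addFb.
congr (_ * _); rewrite [RHS](reindex_inj (@perm_inj _ (tperm i j))) /=.
apply: eq_big => [x|x ex].
  by case: tpermP => [->|->|//]; rewrite ?ei ?ej.
rewrite !(permM (exchange i j) s) exchange_even //; congr (A _ (s _)).
have := exchange_mate ei ej => /conjg_fixP/commgP/permP/(_ x).
by rewrite (permM mate) (permM (exchange i j)) (exchange_even ei ej ex).
Qed.

(** Induction on [potential]: a violation of [matching_perm] is repaired by a [swap] or an
    [exchange], which changes neither the matching nor the term. *)
Lemma matching_rep s : exists t, [/\ matching_perm t, (mate ^ t = mate ^ s)%g &
  forall A, A^T = - A -> pf_term A t = pf_term A s].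
Proof.
have [n] := ubnP (potential s); elim: n s => // n IH s lt_n.
have descend u : (mate ^ u = mate)%g -> (potential (u * s) < potential s)%N ->
    (forall A, A^T = - A -> pf_term A (u * s) = pf_term A s) ->
    exists t, [/\ matching_perm t, (mate ^ t = mate ^ s)%g &
      forall A, A^T = - A -> pf_term A t = pf_term A s].
  move=> uE lt_u uF; have [|t [t1 t2 t3]] := IH (u * s)%g.
    exact: leq_trans lt_u lt_n.
  by exists t; split=> // [|A sA]; rewrite ?t2 ?conjgM ?uE // t3 ?uF.
have [ms|] := boolP (matching_perm s); first by exists s.
rewrite negb_and => /orP[] /forallPn [i] /forallPn [j]; rewrite negb_imply.
  case/andP=> /andP[ei]; rewrite mate_even // => /eqP ->; rewrite -leqNgt => le_s.
  apply: (descend (swap i)) => [||A sA]; [exact: swap_mate| |exact: swap_term].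
  apply: swap_potential => //; rewrite ltn_neqAle le_s andbT.
  by apply/eqP => /val_inj/perm_inj/eqP; apply/negP/mate_neq.
case/andP=> /and3P[ei ej ij]; rewrite -leqNgt => le_s.
apply: (descend (exchange i j)) => [||A sA];
  [exact: exchange_mate| |exact: exchange_term].
apply: exchange_potential => //; rewrite ltn_neqAle le_s andbT.
by apply/eqP => /val_inj/perm_inj ji; move: ij; rewrite ji ltnn.
Qed.

(** Relabelling by [u] permutes the perfect matchings; on normalized representatives this is [s] to
    [nf (s * u)], with the inverse given by [u^-1]. *)
Lemma pfaffian_perm A u : A^T = - A ->
  pfaffian (\matrix_(i, j) A (u i) (u j)) = (-1) ^+ u * pfaffian A.
Proof.
move=> sA; have [nf nfP] := fin_all_exists matching_rep.
have nfm s : matching_perm (nf s) by case: (nfP s).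
have nfJ s : (mate ^ nf s = mate ^ s)%g by case: (nfP s).
rewrite !pfaffianE mulr_sumr.
rewrite [RHS](reindex_onto (fun s => nf (s * u)%g) (fun t => nf (t * u^-1)%g)) /=.
  apply: eq_big => [s|s ms].
    rewrite nfm /=; apply/idP/eqP => [ms|<-]; last exact: nfm.
    by apply: matching_uniq => //; rewrite nfJ conjgM nfJ -conjgM mulgK.
  have [_ _ ->] := nfP (s * u)%g; last by [].
  rewrite /pf_term odd_permM signr_addb -mulrA mulrCA signrMK; congr (_ * _).
  by apply: eq_bigr => i _; rewrite !mxE !permM.
by move=> t mt; apply: matching_uniq => //; rewrite nfJ conjgM nfJ -conjgM mulgKV.
Qed.

(** What is left of [pf_term A s] without the factor of the pair containing [k]; the second sign
    reverses the indices of that factor when [k] comes second in its pair. *)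
Definition pf_cofactor A k s : R :=
  (-1) ^+ s * (-1) ^+ odd ((s^-1)%g k) *
  \prod_(i < N | ~~ odd i && ((s i != k) && (s (mate i) != k))) A (s i) (s (mate i)).

Lemma pf_term_row A k s : A^T = - A ->
  pf_term A s = A k ((mate ^ s)%g k) * pf_cofactor A k s.
Proof.
move=> sA; rewrite /pf_term /pf_cofactor.
have -> : (mate ^ s)%g k = s (mate ((s^-1)%g k)) by rewrite !permM.
set x := (s^-1)%g k; have kE : k = s x by rewrite permKV.
have [ox|ex] := boolP (odd x).
  have em : ~~ odd (mate x) by rewrite odd_mate ox.
  rewrite (bigD1 (mate x)) //= mateK -kE skew_entry // expr1.
  rewrite (eq_bigl (fun i => ~~ odd i && ((s i != k) && (s (mate i) != k)))); last first.
    move=> i; rewrite kE !(inj_eq perm_inj) (can2_eq mateK mateK).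
    case: (boolP (odd i)) => //= ei; suff -> : i != x by [].
    by apply/eqP => E; move: ei; rewrite E ox.
  by rewrite mulrN1 !mulNr !mulrN mulrCA.
rewrite (bigD1 x) //= -kE expr0.
rewrite (eq_bigl (fun i => ~~ odd i && ((s i != k) && (s (mate i) != k)))).
  by rewrite mulr1 mulrCA.
move=> i; rewrite kE !(inj_eq perm_inj) (can2_eq mateK mateK) andbA.
case: (boolP (odd i)) => //= ei; suff -> : i != mate x by rewrite andbT.
by apply/eqP => E; move: ei; rewrite E odd_mate ex.
Qed.

Definition pf_adj A : 'M[R]_N :=
  \matrix_(j, k) \sum_(s | matching_perm s && ((mate ^ s)%g k == j)) pf_cofactor A k s.

Lemma pfaffian_row A k : A^T = - A -> pfaffian A = \sum_j A k j * pf_adj A j k.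
Proof.
move=> sA; rewrite pfaffianE (partition_big (fun s => (mate ^ s)%g k) predT) //=.
apply: eq_bigr => j _; rewrite mxE mulr_sumr; apply: eq_bigr => s /andP[_ /eqP <-].
exact: pf_term_row.
Qed.

(** No factor of a cofactor at [k] involves [k], so row and column [k] may be replaced freely. *)
Lemma pf_adj_eq A A' j k :
  (forall i1 i2, i1 != k -> i2 != k -> A i1 i2 = A' i1 i2) ->
  pf_adj A j k = pf_adj A' j k.
Proof.
move=> AA'; rewrite !mxE; apply: eq_bigr => s _; congr (_ * _).
by apply: eq_bigr => i /andP[_ /andP[n1 n2]]; apply: AA'.
Qed.

Lemma pf_adj_diag A k : pf_adj A k k = 0.
Proof.
rewrite mxE big_pred0 // => s; apply/andP => -[_].
rewrite !permM (canF_eq (permK s)) => /eqP E.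
by have := mate_neq ((s^-1)%g k); rewrite E eqxx.
Qed.

Lemma mulmx_pf_adj A : (2%:R : R) \is a GRing.unit -> A^T = - A ->
  A *m pf_adj A = (pfaffian A)%:M.
Proof.
move=> h2 sA; apply/matrixP => l k; rewrite !mxE.
have [-> | lk] := eqVneq l k; first by rewrite mulr1n (pfaffian_row k sA).
have eq0 (a : R) : a = - a -> a = 0.
  by move=> aE; apply: (mulrI h2); rewrite mulr0 mulr_natl mulr2n {1}aE addNr.
pose p i := if i == k then l else i.
pose A' : 'M[R]_N := \matrix_(i, j) A (p i) (p j).
have sA' : A'^T = - A' by apply/matrixP => i j; rewrite !mxE skew_entry.
have pu i : p (tperm l k i) = p i.
  rewrite /p; case: tpermP => [->|->|//]; rewrite !eqxx ?(negbTE lk) //.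
transitivity (pfaffian A').
  rewrite (pfaffian_row k sA'); apply: eq_bigr => j _.
  rewrite (@pf_adj_eq A' A) => [|i1 i2 n1 n2]; last first.
    by rewrite mxE /p (negbTE n1) (negbTE n2).
  (* At [j = k] the entry [A' k k] is [A l l] instead of [A l k], which is harmless since [pf_adj]
     vanishes on the diagonal. *)
  rewrite [A' _ _]mxE /p eqxx; case: eqVneq => // ->.
  by rewrite pf_adj_diag !mulr0.
apply: eq0; rewrite -{1}[A'](_ : \matrix_(i, j) A' (tperm l k i) (tperm l k j) = _).
  by rewrite pfaffian_perm // odd_tperm lk expr1 mulN1r.
by apply/matrixP => i j; rewrite !mxE !pu.
Qed.

End Terms.

End Matchings.

Lemma pfaffian1_unitmx (R : comUnitRingType) (N : nat) (A : 'M[R]_N) :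
  (2%:R : R) \is a GRing.unit -> ~~ odd N -> A^T = - A -> pfaffian A = 1 ->
  A \in unitmx.
Proof.
move=> h2 eN sA pf1.
by have [] := mulmx1_unit (eq_trans (mulmx_pf_adj eN h2 sA) (congr1 _ pf1)).
Qed.

Unset Implicit Arguments.
Set Strict Implicit.
Set Printing Implicit Defensive.

Theorem theorem5p2 (R : comUnitRingType) (h2 : (2%:R : R) \is a GRing.unit)
    (n : nat) (hn : (2 <= n)%N)
    (phi : 'M[R]_(1 + (2 * n).-1))
    (phi_skew : phi^T = - phi) (phi_pf : pfaffian phi = 1)
    (I : R -> Prop) (hI : is_ideal I) :
  is_normal_subgroup (ESp_rel phi I) (Sp phi).
Proof.
(* The size [1 + (2 * n).-1] is even only because [n] is positive. *)
have phi_unit : phi \in unitmx by apply: pfaffian1_unitmx => //; lia.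
by apply: ESp_rel_normal => //; lia.
Qed.
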